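(* Let $\Gamma$ and $\Gamma'$ be strongly connected digraphs of orders $n$ and $n'$, respectively, such that every vertex of $\Gamma$ is incident with a doubly directed arc and all vertices in $\Gamma'$ have out-degree $r'$. Let $\operatorname{spec}(\mathcal{D}(\Gamma))=\{\partial_1,\dots,\partial_n\}$ and $\operatorname{spec}(\mathcal{A}(\Gamma'))=\{r',\alpha'_2,\dots,\alpha'_{n'}\}$. Then $$\operatorname{spec}(\mathcal{D}(\Gamma\circ\Gamma'))=\{n'\partial_i+2n'-2-r' : i=1,\dots,n\}\cup\{(-(\alpha'_j+2))^{(n)} : j=2,\dots,n'\}.$$ Given $z\in\mathbb{C}$, define $\tilde z=\frac{z-2n'+2+r'}{n'}$, $g=\operatorname{gmult}_{\mathcal{D}(\Gamma)}(\tilde z)$ and $g'=\operatorname{gmult}_{\mathcal{A}(\Gamma')}(-z-2)$. Then $$\operatorname{gmult}_{\mathcal{D}(\Gamma\circ\Gamma')}(z)=\begin{cases} g & \text{if } -z-2\notin\operatorname{spec}(\mathcal{A}(\Gamma'))\setminus\{r'\},\ \tilde z\in\operatorname{spec}(\mathcal{D}(\Gamma));\\ ng' & \text{if } -z-2\in\operatorname{spec}(\mathcal{A}(\Gamma'))\setminus\{r'\},\ \tilde z\notin\operatorname{spec}(\mathcal{D}(\Gamma));\\ ng'+g & \text{if } -z-2\in\operatorname{spec}(\mathcal{A}(\Gamma'))\setminus\{r'\},\ \tilde z\in\operatorname{spec}(\mathcal{D}(\Gamma)),\ ES_{\mathcal{A}(\Gamma')}(-z-2)\perp\mathbf{1}_{n'};\\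 ng' & \text{if } -z-2\in\operatorname{spec}(\mathcal{A}(\Gamma'))\setminus\{r'\},\ \tilde z\in\operatorname{spec}(\mathcal{D}(\Gamma)),\ ES_{\mathcal{A}(\Gamma')}(-z-2)\not\perp\mathbf{1}_{n'};\\ 0 & \text{otherwise.}\end{cases}$$
   Context: A digraph $\Gamma$ has a finite vertex set $V(\Gamma)=\{v_1,\dots,v_n\}$ and a set $E(\Gamma)$ of ordered pairs of distinct vertices (arcs); $n$ is its order. A doubly directed arc is a pair of arcs $(u,v),(v,u)$ both in $E(\Gamma)$. The adjacency matrix $\mathcal{A}(\Gamma)$ has $(i,j)$ entry $1$ if $(v_i,v_j)\in E(\Gamma)$ and $0$ otherwise. A digraph of order at least two is strongly connected if for every pair of vertices $u,v$ there is a dipath from $u$ to $v$; then the distance matrix $\mathcal{D}(\Gamma)$ has $(i,j)$ entry $d(v_i,v_j)$, the length of a shortest dipath from $v_i$ to $v_j$. The lexicographic product $\Gamma\circ\Gamma'$ has vertex set $V(\Gamma)\times V(\Gamma')$ and an arc from $(x,x')$ to $(y,y')$ iff $(x,y)\in E(\Gamma)$, or $x=y$ and $(x',y')\in E(\Gamma')$. $\operatorname{spec}(A)$ is the multiset of complex eigenvalues with algebraic multiplicity; $x^{(m)}$ means $x$ is listed $m$ times and unions are multiset unions. $ES_A(z)$ is the complex eigenspace of $A$ for $z$, $\operatorname{gmult}_A(z)$ its dimension ($0$ if $z$ is not an eigenvalue). $\mathbf{1}_{n'}$ is the all-ones vector, and $ES_A(z)\perp\mathbf{1}_{n'}$ means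 $\mathbf{v}^T\mathbf{1}_{n'}=0$ for every $\mathbf{v}\in ES_A(z)$. *)

(* Defs.v *)
From HB Require Import structures.
From mathcomp Require Import all_boot all_order all_algebra.
From mathcomp Require Import reals complex.
Set Implicit Arguments.
Unset Strict Implicit.
Unset Printing Implicit Defensive.
Import GRing.Theory.
Local Open Scope ring_scope.

Record digraph := Digraph {
  vertex :> finType;
  arc : rel vertex;
  arc_irr : irreflexive arc
}.

Section Digraphs.
Implicit Types G H : digraph.

Definition dipath G (u v : G) (p : seq G) : bool :=
  [&& path (@arc G) u p, last u p == v & uniq (u :: p)].

Definition strongly_connected G : Prop :=
  (2 <= #|G|)%N /\ forall u v : G, exists p, dipath u v p.

(* Dipaths do not repeat vertices, so their length is less than #|G|; the
   value is #|G| when there is no dipath from u to v. *)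
Definition dist G (u v : G) : nat :=
  find (fun k => [exists p : k.-tuple G, dipath u v p]) (iota 0 #|G|).

Lemma dist_le G (u v : G) p : dipath u v p -> (dist u v <= size p)%N.
Proof.
move=> up; have /and3P[_ _ /card_uniqP eq_card] := up.
have lt_p : (size p < #|G|)%N by rewrite -[X in (X <= _)%N]eq_card max_card.
rewrite leqNgt; apply/negP => /(before_find 0%N).
rewrite nth_iota // => /existsP[]; by exists (in_tuple p).
Qed.

Lemma dist_attained G (u v : G) : strongly_connected G ->
  exists2 p, dipath u v p & size p = dist u v.
Proof.
case=> _ /(_ u v)[q uq].
have hs : has (fun k => [exists p : k.-tuple G, dipath u v p]) (iota 0 #|G|).
  have /and3P[_ _ /card_uniqP eq_card] := uq.
  apply/hasP; exists (size q); last by apply/existsP; exists (in_tuple q).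
  by rewrite mem_iota /= -[X in (X <= _)%N]eq_card max_card.
have /existsP[p up] := nth_find 0%N hs.
exists p => //; rewrite size_tuple nth_iota //.
by rewrite -[X in (_ < X)%N](size_iota 0) -has_find.
Qed.

Definition outdeg G (u : G) : nat := #|[set v | arc u v]|.

Definition in_double_arc G (u : G) : Prop := exists v : G, arc u v && arc v u.

Definition lex_arc G H : rel (G * H) :=
  fun x y => arc x.1 y.1 || (x.1 == y.1) && arc x.2 y.2.

Fact lex_arc_irr G H : irreflexive (@lex_arc G H).
Proof. by move=> x; rewrite /lex_arc !arc_irr andbF. Qed.

Definition lexprod G H : digraph := Digraph (@lex_arc_irr G H).

Definition adjmx (C : nzRingType) G : 'M[C]_#|G| :=
  \matrix_(i, j) (arc (enum_val i) (enum_val j))%:R.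

Definition distmx (C : nzRingType) G : 'M[C]_#|G| :=
  \matrix_(i, j) (dist (enum_val i) (enum_val j))%:R.

End Digraphs.

(* Multisets are sequences compared with perm_eq; the multiplicity of x in s is
   count_mem x s. *)
Definition spec (C : closedFieldType) m (A : 'M[C]_m) : seq C :=
  sval (closed_field_poly_normal (char_poly A)).

Lemma char_poly_spec (C : closedFieldType) m (A : 'M[C]_m) :
  char_poly A = \prod_(x <- spec A) ('X - x%:P).
Proof.
rewrite /spec; case: closed_field_poly_normal => s /= {1}->.
by rewrite (monicP (char_poly_monic A)) scale1r.
Qed.

(* eigenspace B z is the left eigenspace {v | v *m B = z *: v}; the row space of
   ES A z consists of the transposes of the vectors v such that A *m v = z *: v. *)
Definition ES (C : fieldType) m (A : 'M[C]_m) (z : C) : 'M[C]_m :=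
  eigenspace A^T z.

Lemma ESP (C : fieldType) m (A : 'M[C]_m) z (v : 'cV[C]_m) :
  reflect (A *m v = z *: v) (v^T <= ES A z)%MS.
Proof.
apply: (iffP eigenspaceP) => [Av|Av].
  by apply: trmx_inj; rewrite trmx_mul Av linearZ.
by rewrite -trmx_mul Av linearZ.
Qed.

Definition gmult (C : fieldType) m (A : 'M[C]_m) (z : C) : nat := \rank (ES A z).

Definition ES_perp_ones (C : fieldType) m (A : 'M[C]_m) (z : C) : Prop :=
  forall v : 'cV[C]_m, (v^T <= ES A z)%MS -> v^T *m const_mx 1 = 0 :> 'M_1.

(* Main.v *)
Require Import Defs.
From HB Require Import structures.
From mathcomp Require Import all_boot all_order all_algebra.
From mathcomp Require Import reals complex.
From mathcomp Require Import perm mxtens ring zify.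
Set Implicit Arguments.
Unset Strict Implicit.
Unset Printing Implicit Defensive.
Import Order.TTheory GRing.Theory Num.Theory.
Local Open Scope ring_scope.
(* arc also names an operation on cyclic sequences. *)
Local Notation arc := Defs.arc.

(** Write n and m for the orders of the two factors, D for the distance matrix
    of the first and A for the adjacency matrix of the second, J for all-ones
    matrices.  A shortest dipath between vertices in different copies of the
    second factor projects to a shortest dipath of the first factor; inside one
    copy the distance is 0, 1 or 2, as the double arcs allow one to leave the
    copy and come back.  Hence, up to the order of the vertices
    [distmx_lexprod],
      z - D(product) = 1 *t N - S *t J,  S = D + 2,  N = A + (z + 2).
    Out-regularity says that the all-ones vector is an eigenvector of N, of
    eigenvalue nu = r + z + 2.

    Everything follows from eliminating in two ways a bordered matrix.  Put
    P = 1 *t N, U = S *t 1 and V = 1 *t 1^T (with 1 the all-ones column).  Then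
    U V = S *t J, P U = nu U, and [P, U; V, 1] reduces on the one hand to
    P - U V, on the other hand to the block-triangular [P, 0; V, nu - V U],
    where V U = m S.
    Taking determinants over polynomials in z,
      nu^n det(z - D(product)) = det(N)^n det(nu - m S),
    and cancelling nu^n, which det(N)^n contains because r is an eigenvalue of
    A, gives the spectrum.  Taking ranks at a fixed z with nu != 0, the nullity
    of P is n gmult_A(-z-2), and that of nu - m S = - m (D - zt) is
    gmult_D(zt).  The nullity of the block-triangular matrix is the sum of the
    two if the rows of V are in the row space of P, that is, if 1 is orthogonal
    to the kernel of N [rank_lblock_sub]; otherwise V maps the kernel of P onto
    everything and only the nullity of P remains [rank_lblock_section].

    When nu = 0, that is -z-2 = r, one cannot divide by nu, and one has to know
    that r is not in the rest of the spectrum of A.  Both points rest on the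
    invertibility of A - r - J [perron_unit], an instance of the maximum
    principle for functions on a strongly connected digraph.  It yields that r
    is a simple root [simple_ones_root], and since 1 *t N - S *t J does not
    change when N and S are replaced by N - J and S - 1 [tens_ones_shift],
    which changes nu to -m, the case nu = 0 reduces to the preceding one
    [gmult_lex_perron]. *)

(** * Bordered and block-triangular matrices *)

Section Bordering.

Variables (R : comPzRingType) (a b : nat).
Variables (P : 'M[R]_a) (U : 'M[R]_(a, b)) (V : 'M[R]_(b, a)).

Lemma border_schur :
  block_mx P U V 1%:M *m block_mx 1%:M 0 (- V) 1%:M
    = block_mx (P - U *m V) U 0 1%:M.
Proof.
by rewrite mulmx_block !mulmx1 !mulmx0 !mul1mx !mulmxN add0r add0r subrr.
Qed.

(** The second elimination of the bordered matrix.  Column operations that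
    clear U would divide by the eigenvalue nu; scaling the last block of
    columns by nu instead keeps the identity valid over any ring, in
    particular over polynomials, and for nu = 0. *)
Lemma border_eigen nu : P *m U = nu *: U ->
  block_mx P U V 1%:M *m block_mx 1%:M (- U) 0 nu%:M
    = block_mx P 0 V (nu%:M - V *m U).
Proof.
move=> PU; rewrite mulmx_block !mulmx1 !mulmx0 !mul1mx !mulmxN !addr0 PU.
by rewrite mul_mx_scalar addNr addrC.
Qed.

Lemma det_border nu : P *m U = nu *: U ->
  nu ^+ b * \det (P - U *m V) = \det P * \det (nu%:M - V *m U).
Proof.
move=> PU; have := congr1 determinant (border_eigen PU).
have := congr1 determinant border_schur.
rewrite !det_mulmx !det_ublock !det_lblock !det1 !mul1r !mulr1 det_scalar.
by move=> -> <-; rewrite mulrC.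
Qed.

End Bordering.

Section BlockRank.

Variable F : fieldType.

Lemma rank_mulmx_unitr m n (A : 'M[F]_(m, n)) (B : 'M_n) :
  B \in unitmx -> \rank (A *m B) = \rank A.
Proof. by move=> Bu; apply: mxrankMfree; rewrite row_free_unit. Qed.

Lemma rank_mulmx_unitl m n (A : 'M[F]_m) (B : 'M_(m, n)) :
  A \in unitmx -> \rank (A *m B) = \rank B.
Proof. by move=> Au; rewrite (eqmxMfull _ _) // row_full_unit. Qed.

Lemma unit_ublock a b (U : 'M[F]_(a, b)) (Q : 'M_b) : Q \in unitmx ->
  block_mx 1%:M U 0 Q \in unitmx.
Proof. by rewrite !unitmxE det_ublock det1 mul1r. Qed.

Lemma unit_lblock a b (V : 'M[F]_(b, a)) :
  block_mx 1%:M 0 V 1%:M \in unitmx.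
Proof. by rewrite unitmxE det_lblock !det1 mulr1 unitr1. Qed.

Variables (a b : nat) (P : 'M[F]_a) (V : 'M[F]_(b, a)) (Q : 'M[F]_b).

Lemma rank_border (U : 'M[F]_(a, b)) nu : nu != 0 -> P *m U = nu *: U ->
  (\rank (P - U *m V)%R + b = \rank (block_mx P 0 V (nu%:M - V *m U)))%N.
Proof.
move=> nu0 PU; rewrite -(border_eigen V PU) rank_mulmx_unitr; last first.
  by rewrite unit_ublock // unitmxE det_scalar unitfE expf_neq0.
rewrite -(rank_mulmx_unitr (block_mx P U V 1%:M) (unit_lblock (- V))).
rewrite border_schur.
have -> : block_mx (P - U *m V) U 0 1%:M
    = block_mx 1%:M U 0 1%:M *m block_mx (P - U *m V) 0 0 1%:M.
  by rewrite mulmx_block !mulmx0 !mul0mx !mulmx1 !mul1mx !addr0 !add0r.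
by rewrite rank_mulmx_unitl ?unit_ublock ?unitmx1 // rank_diag_block_mx mxrank1.
Qed.

Lemma rank_lblock_sub : (V <= P)%MS ->
  \rank (block_mx P 0 V Q) = (\rank P + \rank Q)%N.
Proof.
case/submxP=> W ->; rewrite -rank_diag_block_mx.
rewrite -(rank_mulmx_unitl (block_mx P 0 0 Q) (unit_lblock W)) mulmx_block.
by rewrite !mulmx0 !mul0mx !mul1mx !addr0 !add0r.
Qed.

Lemma rank_lblock_unit : Q \in unitmx ->
  \rank (block_mx P 0 V Q) = (\rank P + b)%N.
Proof.
move=> Qu; rewrite -[b in RHS](mxrank_unit Qu) -rank_diag_block_mx.
rewrite -(rank_mulmx_unitr (block_mx P 0 0 Q) (unit_lblock (invmx Q *m V))).
rewrite mulmx_block !mulmx0 !mul0mx !mulmx1 !addr0 !add0r.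
by rewrite mulmxA mulmxV // mul1mx.
Qed.

End BlockRank.

(** If V maps the kernel of P onto everything (E is a section), then columns
    of V can be combined freely without touching P, so that the corner Q can be
    replaced with the identity. *)
Lemma rank_lblock_section (F : fieldType) a b (P : 'M[F]_a) (V : 'M_(b, a))
    (Q : 'M_b) (E : 'M_(a, b)) :
  P *m E = 0 -> V *m E = 1%:M ->
  \rank (block_mx P 0 V Q) = (\rank P + b)%N.
Proof.
move=> PE VE; rewrite -(rank_lblock_unit P V (unitmx1 F b)).
rewrite -(rank_mulmx_unitr (block_mx P 0 V Q)
            (unit_ublock (E *m (1%:M - Q)) (unitmx1 _ _))).
rewrite mulmx_block !mulmx0 !mulmx1 !addr0 !mulmxA PE VE mul0mx mul1mx.
by rewrite subrK.
Qed.

(** * Tensor products with identity and all-ones matrices *)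

Lemma det_castmx (R : comPzRingType) m n (e e' : m = n) (A : 'M[R]_m) :
  \det (castmx (e, e') A) = \det A.
Proof.
by rewrite (eq_irrelevance e' e); case: n / e {e'}; rewrite castmx_id.
Qed.

Lemma rank_castmx (F : fieldType) m n m' n' (e : (m = m') * (n = n'))
  (A : 'M[F]_(m, n)) : \rank (castmx e A) = \rank A.
Proof. by case: e => e e'; case: m' / e; case: n' / e'; rewrite castmx_id. Qed.

Lemma det_tens1mx (R : comPzRingType) n m (N : 'M[R]_m) :
  \det ((1%:M : 'M_n) *t N) = \det N ^+ n.
Proof.
elim: n => [|n IHn]; first by rewrite [_ *t _]flatmx0 det_mx00.
rewrite (scalar_mx_block 1 n) (@tens_block_mx _ n n) det_castmx !tens0mx.
by rewrite det_lblock IHn tens_scalar1mx det_castmx exprS.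
Qed.

Lemma rank_tens1mx (F : fieldType) n m (N : 'M[F]_m) :
  \rank ((1%:M : 'M_n) *t N) = (n * \rank N)%N.
Proof.
elim: n => [|n IHn]; first by rewrite [_ *t _]flatmx0 mxrank0.
rewrite (scalar_mx_block 1 n) (@tens_block_mx _ n n) rank_castmx.
by rewrite !tens0mx rank_diag_block_mx IHn tens_scalar1mx rank_castmx mulSn.
Qed.

Lemma det_tensmx1 (R : comPzRingType) n (M : 'M[R]_n) :
  \det (M *t (1%:M : 'M_1)) = \det M.
Proof. by rewrite tens_mx_scalar det_castmx scale1r. Qed.

Lemma rank_tensmx1 (F : fieldType) n (M : 'M[F]_n) :
  \rank (M *t (1%:M : 'M_1)) = \rank M.
Proof. by rewrite tens_mx_scalar rank_castmx scale1r. Qed.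

Lemma tens1mx1 (R : pzRingType) m n :
  (1%:M : 'M[R]_m) *t (1%:M : 'M_n) = 1%:M.
Proof.
apply/matrixP => i j.
case: (mxtens_indexP i) => i1 i2; case: (mxtens_indexP j) => j1 j2.
rewrite tensmxE !mxE (inj_eq (can_inj (@mxtens_indexK _ _))) xpair_eqE.
by rewrite -natrM mulnb.
Qed.

Lemma tensmxBl (R : pzRingType) m n p q (A B : 'M[R]_(m, n)) (C : 'M_(p, q)) :
  (A - B) *t C = A *t C - B *t C.
Proof. by apply/matrixP => i j; rewrite !mxE mulrBl. Qed.

Lemma tensmxZr (R : comPzRingType) m n p q c
    (A : 'M[R]_(m, n)) (B : 'M_(p, q)) :
  A *t (c *: B) = c *: (A *t B).
Proof. by apply/matrixP => i j; rewrite !mxE mulrCA. Qed.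

Lemma tensmxZl (R : pzRingType) m n p q c
    (A : 'M[R]_(m, n)) (B : 'M_(p, q)) :
  (c *: A) *t B = c *: (A *t B).
Proof. by apply/matrixP => i j; rewrite !mxE mulrA. Qed.

Lemma mul_const_mx1 (R : pzRingType) m n p :
  (const_mx 1 : 'M[R]_(m, n)) *m (const_mx 1 : 'M_(n, p)) = const_mx n%:R.
Proof.
apply/matrixP => i j; rewrite !mxE (eq_bigr (fun=> 1)) => [|k _].
  by rewrite sumr_const card_ord.
by rewrite !mxE mulr1.
Qed.

Section TensorOnes.

Variables (n m : nat).

Definition tens_ones (R : pzRingType) (S : 'M[R]_n) (N : 'M[R]_m) :
  'M[R]_(n * m) := 1%:M *t N - S *t const_mx 1.

(** A multiple of 1 *t J can be moved between the two terms, which changes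
    the eigenvalue of N at the all-ones vector. *)
Lemma tens_ones_shift (R : comPzRingType) (S : 'M[R]_n) (N : 'M[R]_m) t :
  tens_ones (S + t%:M) (N + t *: const_mx 1) = tens_ones S N.
Proof.
rewrite /tens_ones.
apply/matrixP => i j; rewrite !mxE; move: (_ == _) => a.
by case: a; rewrite /=; ring.
Qed.

(** The rows and columns of U and V are indexed by 'I_(n * 1), so that the
    mixed product rule of tensors applies to them; the resulting factors
    _ *t 1%:M are removed by [det_tensmx1] and [rank_tensmx1]. *)
Section Ring.
Variables (R : comPzRingType) (S : 'M[R]_n) (N : 'M[R]_m) (nu : R).
Hypothesis Nones : N *m const_mx 1 = nu *: const_mx 1 :> 'cV_m.

Let U : 'M_(n * m, n * 1) := S *t const_mx 1.
Let V : 'M[R]_(n * 1, n * m) := 1%:M *t const_mx 1.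

Lemma tens_onesE : tens_ones S N = 1%:M *t N - U *m V.
Proof. by rewrite tensmx_mul mulmx1 mul_const_mx1. Qed.

Lemma tens_ones_eigen : (1%:M *t N) *m U = nu *: U.
Proof. by rewrite tensmx_mul mul1mx Nones tensmxZr. Qed.

Lemma tens_ones_quotient : nu%:M - V *m U = (nu%:M - m%:R *: S) *t 1%:M.
Proof.
rewrite tensmx_mul mul1mx mul_const_mx1 tensmxBl.
have -> : const_mx m%:R = m%:R *: (1%:M : 'M[R]_1).
  by apply/matrixP => i j; rewrite !mxE !ord1 eqxx mulr1.
by rewrite tensmxZr tensmxZl -[nu%:M in RHS]scalemx1 tensmxZl tens1mx1 scalemx1.
Qed.

Lemma det_tens_ones :
  nu ^+ n * \det (tens_ones S N) = \det N ^+ n * \det (nu%:M - m%:R *: S).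
Proof.
rewrite tens_onesE -{1}[n]muln1 (det_border _ tens_ones_eigen).
by rewrite tens_ones_quotient det_tens1mx det_tensmx1.
Qed.

End Ring.

Section Field.
Variables (F : fieldType) (S : 'M[F]_n) (N : 'M[F]_m) (nu : F).
Hypothesis Nones : N *m const_mx 1 = nu *: const_mx 1 :> 'cV_m.
Hypothesis nu0 : nu != 0.

Lemma rank_tens_ones :
  (\rank (tens_ones S N) + n)%N = \rank (block_mx (1%:M *t N) 0
     ((1%:M : 'M_n) *t const_mx 1) ((nu%:M - m%:R *: S) *t (1%:M : 'M_1))).
Proof.
rewrite tens_onesE -[X in (_ + X)%N = _]muln1.
by rewrite (rank_border _ nu0 (tens_ones_eigen _ Nones)) tens_ones_quotient.
Qed.

Lemma rank_tens_ones_sub : ((const_mx 1 : 'rV_m) <= N)%MS ->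
  (\rank (tens_ones S N) + n = n * \rank N + \rank (nu%:M - m%:R *: S)%R)%N.
Proof.
case/submxP => W onesE; rewrite rank_tens_ones rank_lblock_sub.
  by rewrite rank_tens1mx rank_tensmx1.
by apply/submxP; exists (1%:M *t W); rewrite tensmx_mul mul1mx -onesE.
Qed.

Lemma rank_tens_ones_unit : nu%:M - m%:R *: S \in unitmx ->
  \rank (tens_ones S N) = (n * \rank N)%N.
Proof.
move=> Qu; apply: (@addIn n); rewrite rank_tens_ones rank_lblock_unit.
  by rewrite rank_tens1mx muln1.
by rewrite unitmxE det_tensmx1 -unitmxE.
Qed.

Lemma rank_tens_ones_section (v : 'cV_m) : N *m v = 0 ->
  (const_mx 1 : 'rV_m) *m v != 0 -> \rank (tens_ones S N) = (n * \rank N)%N.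
Proof.
move=> Nv v1; apply: (@addIn n); rewrite rank_tens_ones.
pose c := ((const_mx 1 : 'rV_m) *m v) 0 0.
have c1 : (const_mx 1 : 'rV_m) *m v = c%:M by apply: mx11_scalar.
have c0 : c != 0 by apply: contraNneq v1 => c0; rewrite c1 c0 raddf0.
rewrite (@rank_lblock_section _ _ _ _ _ _ (1%:M *t (c^-1 *: v))).
- by rewrite rank_tens1mx muln1.
- by rewrite tensmx_mul -scalemxAr Nv scaler0 tensmx0.
- by rewrite tensmx_mul mul1mx -scalemxAr c1 scale_scalar_mx mulVf // tens1mx1.
Qed.

End Field.
End TensorOnes.

(** * Relabelling rows and columns *)

Lemma mxsub_bij_perm (R : comPzRingType) m n (f : 'I_m -> 'I_n) (A : 'M[R]_n) :
  bijective f ->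
  exists s : 'S_n, exists e : n = m,
    mxsub f f A = castmx (e, e) (perm_mx s *m A *m (perm_mx s)^T).
Proof.
move=> f_bij; have mn : n = m by have := bij_eq_card f_bij; rewrite !card_ord.
case: m / mn in f f_bij *.
exists (perm (bij_inj f_bij)), erefl; rewrite castmx_id tr_perm_mx.
rewrite -row_permE -col_permE.
by apply/matrixP => i j; rewrite !mxE !permE.
Qed.

Lemma det_mxsub_bij (R : comPzRingType) m n (f : 'I_m -> 'I_n) (A : 'M[R]_n) :
  bijective f -> \det (mxsub f f A) = \det A.
Proof.
move=> f_bij; have [s [e ->]] := mxsub_bij_perm A f_bij.
by rewrite det_castmx !det_mulmx det_tr mulrAC -expr2 det_perm sqrr_sign mul1r.
Qed.

Lemma rank_mxsub_bij (F : fieldType) m n (f : 'I_m -> 'I_n) (A : 'M[F]_n) :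
  bijective f -> \rank (mxsub f f A) = \rank A.
Proof.
move=> f_bij; have [s [e ->]] := mxsub_bij_perm A f_bij.
rewrite rank_castmx.
by rewrite rank_mulmx_unitr ?rank_mulmx_unitl ?unitmx_tr ?unitmx_perm.
Qed.

(** * Spectra and eigenspaces *)

Section Spectra.

Variables (C : closedFieldType) (m : nat) (A : 'M[C]_m).

Lemma size_spec : size (spec A) = m.
Proof.
by apply: succn_inj; rewrite -(size_char_poly A) char_poly_spec size_prod_XsubC.
Qed.

Lemma mem_spec x : (x \in spec A) = (A - x%:M \notin unitmx).
Proof.
rewrite -root_prod_XsubC -char_poly_spec -eigenvalue_root_char.
by rewrite /eigenvalue kermx_eq0 row_free_unit.
Qed.

Lemma spec_perm (s : seq C) :
  char_poly A = \prod_(x <- s) ('X - x%:P) -> perm_eq (spec A) s.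
Proof. by rewrite char_poly_spec => /prod_XsubC_eq. Qed.

(** The characteristic polynomial composed with c^-1 p, homogenised. *)
Lemma det_affine (s : seq C) (p : {poly C}) (c : C) : c != 0 ->
  perm_eq (spec A) s ->
  \det (p%:M - c%:P *: map_mx polyC A) = \prod_(x <- s) (p - (c * x)%:P).
Proof.
move=> c0 As.
have -> : p%:M - c%:P *: map_mx polyC A
    = c%:P *: map_mx (comp_poly (c^-1 *: p)) (char_poly_mx A).
  apply/matrixP => i j; rewrite !mxE rmorphB /= comp_polyC rmorphMn /=.
  by rewrite comp_polyX mulrBr mulrnAr !mul_polyC scalerA mulfV // scale1r.
rewrite detZ det_map_mx -/(char_poly A) char_poly_spec rmorph_prod /=.
rewrite (perm_big _ As) /= -[X in _ ^+ X]size_spec (perm_size As).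
have -> : c%:P ^+ size s = \prod_(x <- s) c%:P.
  by rewrite big_const_seq count_predT -Monoid.iteropE.
rewrite -big_split /=; apply: eq_bigr => x _.
rewrite rmorphB /= comp_polyX comp_polyC mulrBr mul_polyC scalerA mulfV //.
by rewrite scale1r polyCM.
Qed.

End Spectra.

Lemma gmultE (F : fieldType) m (A : 'M[F]_m) z :
  gmult A z = (m - \rank (A - z%:M)%R)%N.
Proof.
rewrite /gmult /ES mxrank_ker -[in RHS]mxrank_tr.
by rewrite [(A - _)^T]raddfB /= tr_scalar_mx.
Qed.

Lemma ESE (F : fieldType) m (A : 'M[F]_m) z (v : 'cV_m) :
  (v^T <= ES A z)%MS = ((A - z%:M) *m v == 0).
Proof. by rewrite mulmxBl mul_scalar_mx subr_eq0; apply/ESP/eqP. Qed.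

(** The columns of a cokernel of A - z span the eigenspace, so that
    orthogonality to it is membership in the row space of A - z. *)
Lemma ES_perp_onesP (F : fieldType) m (A : 'M[F]_m) z : ES_perp_ones A z ->
  ((const_mx 1 : 'rV_m) <= A - z%:M)%MS.
Proof.
move=> perp; rewrite submxE; set K := cokermx _.
apply/eqP/matrixP => i j; rewrite ord1 [RHS]mxE.
have /perp : ((col j K)^T <= ES A z)%MS.
  by rewrite ESE colE mulmxA mulmx_coker mul0mx.
move/matrixP/(_ 0 0); rewrite !mxE => {2}<-.
by apply: eq_bigr => k _; rewrite !mxE mulrC.
Qed.

Lemma not_ES_perp_ones (F : fieldType) m (A : 'M[F]_m) z : ~ ES_perp_ones A z ->
  exists2 v : 'cV_m, (A - z%:M) *m v = 0 & (const_mx 1 : 'rV_m) *m v != 0.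
Proof.
move=> nperp; set K := cokermx (A - z%:M).
have [/eqP|] := eqVneq ((const_mx 1 : 'rV_m) *m K) 0.
  rewrite -submxE => /submxP[W onesE]; case: nperp => v.
  rewrite ESE => /eqP Av; apply: trmx_inj.
  by rewrite trmx_mul trmxK trmx_const onesE -mulmxA Av mulmx0 trmx0.
case/matrix0Pn => i [j nz]; exists (col j K).
  by rewrite colE mulmxA mulmx_coker mul0mx.
by rewrite colE mulmxA -colE; apply/matrix0Pn; exists i, 0; rewrite mxE.
Qed.

(** Subtracting J moves the eigenvalue r of the all-ones vector to r - m and
    keeps the rest s of the spectrum; it is [det_border] for the rank-one
    matrix J.  So r in s would be an eigenvalue of A - J. *)
Lemma simple_ones_root (C : closedFieldType) m (A : 'M[C]_m) r (s : seq C) :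
  A *m const_mx 1 = r *: const_mx 1 :> 'cV_m ->
  A - r%:M - const_mx 1 \in unitmx ->
  perm_eq (spec A) (r :: s) -> r \notin s.
Proof.
move=> Aones Nu As.
pose U : 'cV[{poly C}]_m := const_mx 1.
pose V : 'rV[{poly C}]_m := - const_mx 1.
pose P := char_poly_mx A.
have PU : P *m U = ('X - r%:P) *: U.
  rewrite mulmxBl mul_scalar_mx scalerBl; congr (_ - _).
  have -> : U = map_mx polyC (const_mx 1) by rewrite map_const_mx.
  by rewrite -map_mxM Aones map_mxZ.
have := det_border V PU; rewrite expr1.
have -> : P - U *m V = char_poly_mx (A - const_mx 1).
  rewrite mulmxN opprK mul_const_mx1 /char_poly_mx map_mxB map_const_mx opprB.
  by rewrite addrA addrAC -addrA.
have -> : \det (('X - r%:P)%:M - V *m U) = 'X - (r - m%:R)%:P.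
  rewrite mulNmx opprK mul_const_mx1 det_mx11 !mxE eqxx mulr1n.
  by rewrite polyCB polyC_natr opprB addrA addrAC.
rewrite -/(char_poly A) -/(char_poly _) [char_poly A]char_poly_spec.
rewrite (perm_big _ As) /= big_cons -mulrA.
move/(mulfI (monic_neq0 (monicXsubC r))).
move/(congr1 (fun p => root p r)); rewrite rootM root_prod_XsubC.
rewrite -eigenvalue_root_char /eigenvalue kermx_eq0 row_free_unit addrAC Nu /=.
by move/esym/negbT; rewrite negb_or => /andP[].
Qed.

(** * Distances in the lexicographic product *)

Section Distances.

Implicit Types G H : digraph.

Lemma walk_dipath G (u : G) p : path (@arc G) u p ->
  exists2 q, dipath u (last u p) q & (size q <= size p)%N.
Proof.
case/shortenP => q uq q_uniq sub_qp; exists q.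
  by rewrite /dipath uq eqxx q_uniq.
by apply: uniq_leq_size => //; case/andP: q_uniq.
Qed.

Lemma dist_walk G (u : G) p : path (@arc G) u p ->
  (dist u (last u p) <= size p)%N.
Proof. by case/walk_dipath => q /dist_le /leq_trans; apply. Qed.

Lemma dist_refl G (u : G) : dist u u = 0%N.
Proof. by apply/eqP; rewrite -leqn0 (@dist_walk _ u [::]). Qed.

Lemma dist_arc G (u v : G) : arc u v -> (dist u v <= 1)%N.
Proof. by move=> uv; apply: (@dist_walk _ u [:: v]); rewrite /= uv. Qed.

Lemma dist_arc2 G (u v w : G) : arc u v -> arc v w -> (dist u w <= 2)%N.
Proof.
by move=> uv vw; apply: (@dist_walk _ u [:: v; w]); rewrite /= uv vw.
Qed.

Section StrongDist.

Variables (G : digraph) (scG : strongly_connected G).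
Implicit Types u v : G.

Lemma dist_eq0 u v : (dist u v == 0%N) = (u == v).
Proof.
apply/eqP/eqP => [d0|->]; last exact: dist_refl.
have [p /and3P[_ /eqP lp _]] := dist_attained u v scG.
by rewrite d0 => /size0nil p0; rewrite p0 in lp.
Qed.

Lemma dist_eq1 u v : dist u v = 1%N -> arc u v.
Proof.
move=> d1; have [p /and3P[up /eqP lp _]] := dist_attained u v scG.
by case: p up lp => [|w [|]]; rewrite d1 //= andbT => uw <-.
Qed.

End StrongDist.

Variables (G H : digraph).
Hypotheses (scG : strongly_connected G) (scH : strongly_connected H).
Hypothesis dblG : forall u : G, in_double_arc u.

Local Notation L := (lexprod G H).

(** The first arc of the walk already lies in the first factor, so it may
    change the second coordinate to any value. *)
Lemma lift_walk (x : G) (x' y' : H) p : path (@arc G) x p -> p != [::] ->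
  exists q, [/\ path (@arc L) (x, x') q, last (x, x') q = (last x p, y') &
                size q = size p].
Proof.
elim: p x x' => //= y p IHp x x' /andP[xy yp] _.
have xy' : lex_arc (x, x') (y, y') by rewrite /lex_arc xy.
have [->|p0] := eqVneq p [::]; first by exists [:: (y, y')]; rewrite /= xy'.
have [q [yq lq sq]] := IHp y y' yp p0.
by exists ((y, y') :: q); rewrite /= xy' yq lq sq.
Qed.

(** Arcs that stay inside a copy of H are dropped. *)
Lemma project_walk (u : L) q : path (@arc L) u q ->
  exists p, [/\ path (@arc G) u.1 p, last u.1 p = (last u q).1 &
                (size p <= size q)%N].
Proof.
elim: q u => [|v q IHq] u /=; first by exists [::].
case/andP=> uv /IHq[p [vp lp sp]].
case/orP: uv => [uv|/andP[/eqP -> _]]; last by exists p; rewrite leqW.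
by exists (v.1 :: p); rewrite /= uv.
Qed.

Lemma lexprod_neighbour (x : G) (x' y' : H) :
  (dist ((x, x') : L) (x, y') <= 2)%N.
Proof.
have [w /andP[xw wx]] := dblG x.
by apply: (@dist_arc2 L _ (w, x')); rewrite /= /lex_arc ?xw ?wx.
Qed.

(** Starting with a double arc makes the walk in G nonempty, so that
    [lift_walk] applies also when x = y. *)
Lemma lexprod_connected : strongly_connected L.
Proof.
split=> [|[x x'] [y y']].
  case: scG scH => G2 _ [H2 _]; rewrite card_prod.
  by apply: leq_trans (leq_mul G2 H2).
have [w /andP[xw wx]] := dblG x.
have [p /and3P[xp /eqP lp _] _] := dist_attained w y scG.
have xwp : path (@arc G) x (w :: p) by rewrite /= xw.
have [//|q [xq lq _]] := @lift_walk x x' y' (w :: p) xwp.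
have [q' q'P _] := walk_dipath xq; exists q'.
by rewrite lq /= lp in q'P.
Qed.

Lemma dist_lexprod (x y : G) (x' y' : H) :
  dist ((x, x') : L) (y, y') =
    if x == y then (if x' == y' then 0 else if arc x' y' then 1 else 2)%N
    else dist x y.
Proof.
have scL := lexprod_connected.
have [<-|xy] := eqVneq x y.
  have [<-|x'y'] := eqVneq x' y'; first exact: dist_refl.
  have d0 : dist ((x, x') : L) (x, y') != 0%N.
    by rewrite dist_eq0 // xpair_eqE eqxx.
  have := lexprod_neighbour x x' y'.
  case: ifP => [a' _|na' le2].
    apply/eqP; rewrite eqn_leq lt0n d0 andbT; apply: dist_arc.
    by rewrite /= /lex_arc eqxx a' orbT.
  apply/eqP; rewrite eqn_leq le2 ltn_neqAle lt0n d0 andbT eq_sym.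
  apply: contraFN na' => /eqP/(dist_eq1 scL) /=.
  by rewrite /lex_arc arc_irr eqxx.
apply/eqP; rewrite eqn_leq; apply/andP; split.
  have [p /and3P[xp /eqP lp _] <-] := dist_attained x y scG.
  have [|q [xq lq <-]] := @lift_walk x x' y' p xp.
    by apply: contraNneq xy => p0; rewrite p0 in lp; rewrite -lp.
  by have := dist_walk xq; rewrite lq lp.
have [q /and3P[xq /eqP lq _] <-] := dist_attained ((x, x') : L) (y, y') scL.
have [p [xp lp sp]] := project_walk xq.
by apply: leq_trans sp; have := dist_walk xp; rewrite lp lq.
Qed.

End Distances.

(** * The distance matrix of the product *)

Definition lex_tensor (K : comPzRingType) n m (D : 'M[K]_n) (A : 'M[K]_m) :=
  D *t const_mx 1 + 1%:M *t (2 *: const_mx 1 - 2%:M - A).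

Section LexMatrix.

Variables (G H : digraph).

Definition lex_index (k : 'I_#|lexprod G H|) : 'I_(#|G| * #|H|) :=
  mxtens_index (enum_rank (enum_val k).1, enum_rank (enum_val k).2).

Lemma lex_index_bij : bijective lex_index.
Proof.
exists (fun k => enum_rank
  ((enum_val (mxtens_unindex k).1, enum_val (mxtens_unindex k).2)
     : lexprod G H)).
  move=> k; rewrite /lex_index mxtens_indexK /= !enum_rankK.
  by rewrite -surjective_pairing enum_valK.
move=> k; rewrite -[RHS]mxtens_unindexK; case: (mxtens_unindex k) => i j.
by rewrite /lex_index enum_rankK /= !enum_valK.
Qed.

Hypotheses (scG : strongly_connected G) (scH : strongly_connected H).
Hypothesis dblG : forall u : G, in_double_arc u.

Lemma distmx_lexprod (C : comNzRingType) :
  distmx C (lexprod G H) = mxsub lex_index lex_index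
    (lex_tensor (distmx C G) (adjmx C H)).
Proof.
apply/matrixP => k l.
rewrite mxE [RHS]mxE [RHS]mxE !tensmxE !mxE !enum_rankK /=.
rewrite (surjective_pairing (enum_val k)) (surjective_pairing (enum_val l)).
rewrite dist_lexprod // !(inj_eq enum_rank_inj) !mulr1.
have [->|_] := eqVneq; last by rewrite mul0r addr0.
rewrite dist_refl add0r mul1r.
have [->|_] := eqVneq; first by rewrite arc_irr subrr subr0.
by case: ifP => _; rewrite !subr0 // -[2]/(1 + 1) addrK.
Qed.

End LexMatrix.

(** * The maximum principle and the Perron root *)

Lemma sum_enum_val (V : nmodType) (T : finType) (F : T -> V) :
  \sum_(k < #|T|) F (enum_val k) = \sum_x F x.
Proof.
rewrite [RHS](reindex (fun k : 'I_#|T| => enum_val k)) //=.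
by exists enum_rank => x _; rewrite ?enum_valK ?enum_rankK.
Qed.

Lemma adjmx_mulE (C : nzRingType) (G : digraph) (f : G -> C) k :
  (adjmx C G *m \col_i f (enum_val i)) k 0 = \sum_(w | arc (enum_val k) w) f w.
Proof.
rewrite mxE [RHS]big_mkcond -[RHS]sum_enum_val; apply: eq_bigr => i _.
by rewrite !mxE; case: arc; rewrite ?mul1r ?mul0r.
Qed.

Section Perron.

Variables (G : digraph) (r : nat).
Hypothesis scG : strongly_connected G.
Hypothesis outG : forall u : G, outdeg u = r.

Lemma sum_out_const (C : pzRingType) (u : G) (a : C) :
  \sum_(w | arc u w) a = r%:R * a.
Proof.
rewrite sumr_const mulr_natl -(outG u).
by congr (_ *+ _); apply: eq_card => w; rewrite !inE.
Qed.

(** At a maximum u of f the terms f u - f w are nonnegative and have sum -c,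
    so they vanish: the out-neighbours of u are maxima as well, and
    every vertex is reached from u. *)
Lemma harmonic_const_ge0 (F : realFieldType) (f : G -> F) c : 0 <= c ->
  (forall u, \sum_(w | arc u w) f w = r%:R * f u + c) -> forall u v, f u = f v.
Proof.
move=> c0 fE.
have [u0 _] : exists u0 : G, true.
  by have /card_gt0P[u _] : (0 < #|G|)%N; [exact: leq_trans scG.1 | exists u].
have [u _ umax] := @Order.TotalTheory.arg_maxP _ _ _ u0 xpredT f isT.
suff fu v : f v = f u by move=> x y; rewrite !fu.
have [p /and3P[up /eqP <- _]] := scG.2 u v.
elim: {v} p u up umax => //= w p IHp u /andP[uw wp] umax.
have gap0 : \sum_(v | arc u v) (f u - f v) = - c.
  by rewrite sumrB fE sum_out_const opprD addNKr.
have gap_ge0 v : arc u v -> 0 <= f u - f v by rewrite subr_ge0 umax.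
have sum0 : \sum_(v | arc u v) (f u - f v) = 0.
  by apply/le_anti; rewrite sumr_ge0 // gap0 oppr_le0 c0.
have fw : f w = f u.
  by apply/esym/eqP; rewrite -subr_eq0 (psumr_eq0P gap_ge0 sum0).
by rewrite -fw IHp // => v _; rewrite fw umax.
Qed.

Lemma harmonic_const (F : realFieldType) (f : G -> F) c :
  (forall u, \sum_(w | arc u w) f w = r%:R * f u + c) -> forall u v, f u = f v.
Proof.
move=> fE; have [c0|/ltW c0] := leP 0 c; first exact: harmonic_const_ge0 fE.
move=> u v; apply: oppr_inj.
apply: (@harmonic_const_ge0 _ (fun u => - f u) (- c)).
  by rewrite oppr_ge0.
by move=> x; rewrite sumrN fE opprD mulrN.
Qed.

Lemma adjmx_ones (C : nzRingType) :
  adjmx C G *m const_mx 1 = r%:R *: const_mx 1 :> 'cV_#|G|.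
Proof.
apply/matrixP => i j; rewrite ord1.
have -> : const_mx 1 = \col_j (fun=> 1) (enum_val j) :> 'cV[C]_#|G|.
  by apply/matrixP => k l; rewrite !mxE.
by rewrite (adjmx_mulE (fun=> 1)) sum_out_const !mxE.
Qed.

(** A kernel vector v of A - r - J satisfies A v = r v + s 1, where s is the
    sum of its entries; it is constant by [harmonic_const], hence s = 0 and
    v = 0. *)
Lemma perron_unit_real (F : realFieldType) :
  adjmx F G - r%:R%:M - const_mx 1 \in unitmx.
Proof.
set M := _ - const_mx 1; rewrite -unitmx_tr -row_free_unit -kermx_eq0.
apply/eqP/row_matrixP => i; rewrite row0.
set v := row i _; have : M *m v^T = 0.
  by apply: trmx_inj; rewrite trmx_mul trmxK /v -row_mul mulmx_ker row0 trmx0.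
move: v => v Mv; pose f u := v 0 (enum_rank u); pose s := \sum_u f u.
have vE : v^T = \col_j f (enum_val j).
  by apply/matrixP => j k; rewrite !mxE !ord1 /f enum_valK.
have fE u : \sum_(w | arc u w) f w = r%:R * f u + s.
  move/matrixP/(_ (enum_rank u) 0): Mv; rewrite vE !mulmxBl.
  rewrite 2![in LHS]mxE (adjmx_mulE f) mul_scalar_mx !mxE !enum_rankK.
  set t := \sum_j _; have -> : t = s.
    by rewrite /s -sum_enum_val; apply: eq_bigr => j _; rewrite !mxE mul1r.
  by move/eqP; rewrite -addrA -opprD subr_eq0 => /eqP.
have fC := harmonic_const fE.
have s0 : s = 0.
  have [u _] : exists u : G, true.
    by have /card_gt0P[u _] : (0 < #|G|)%N; [exact: leq_trans scG.1 | exists u].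
  move: (fE u); rewrite (eq_bigr (fun=> f u)) => [|w _]; last exact: fC.
  by rewrite sum_out_const -[LHS]addr0 => /addrI/esym.
apply/rowP => j; rewrite mxE -[j]enum_valK -/(f _).
move/eqP: s0; rewrite /s (eq_bigr (fun=> f (enum_val j))); last first.
  by move=> w _; apply: fC.
rewrite sumr_const mulrn_eq0 => /orP[|/eqP //].
by rewrite cardT -cardE -leqn0 leqNgt (leq_trans _ scG.1).
Qed.

(** The maximum principle needs an ordered field; the matrix has rational
    entries, so its invertibility carries over from [rat]. *)
Lemma perron_unit (C : numFieldType) :
  adjmx C G - r%:R%:M - const_mx 1 \in unitmx.
Proof.
have := perron_unit_real rat; rewrite -(map_unitmx (ratr : rat -> C)).
congr (_ \in unitmx); rewrite !map_mxB map_scalar_mx map_const_mx /=.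
rewrite (ratr_nat C 1) ratr_nat; congr (_ - _ - _).
by apply/matrixP => i j; rewrite !mxE ratr_nat.
Qed.

End Perron.

(** * Spectrum and multiplicities of the product *)

Lemma lex_tensorE (K : comPzRingType) n m (D : 'M[K]_n) (A : 'M[K]_m) z :
  z%:M - lex_tensor D A = tens_ones (D + 2%:M) (A + (z + 2)%:M).
Proof.
have -> : z%:M = 1%:M *t z%:M :> 'M_(n * m).
  by rewrite -[z%:M in RHS]scalemx1 tensmxZr tens1mx1 scalemx1.
apply/matrixP => i j; rewrite !mxE; move: (_ == _) (_ == _) => a b.
by case: a; case: b; rewrite /=; ring.
Qed.

(** How the rank identities of [tens_ones] turn into sums of nullities. *)
Lemma nullity_add (a b c k q : nat) : (a <= k)%N -> (q <= b)%N ->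
  (c + b = a + q)%N -> (k - c = (k - a) + (b - q))%N.
Proof. lia. Qed.

Section LexSpectrum.

Variables (C : numClosedFieldType) (G H : digraph) (r : nat).
Hypotheses (scG : strongly_connected G) (scH : strongly_connected H).
Hypotheses (dblG : forall u : G, in_double_arc u).
Hypothesis outH : forall u : H, outdeg u = r.

Local Notation n := #|G|.
Local Notation m := #|H|.
Local Notation D := (distmx C G).
Local Notation A := (adjmx C H).
Local Notation L := (lexprod G H).

Let distL :
  distmx C L = mxsub (@lex_index G H) (@lex_index G H) (lex_tensor D A).
Proof. exact: distmx_lexprod. Qed.

Let index_inj : injective (@lex_index G H).
Proof. exact: bij_inj (@lex_index_bij G H). Qed.

Let m_neq0 : m%:R != 0 :> C.
Proof. by rewrite pnatr_eq0 -lt0n; apply: leq_trans scH.1. Qed.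

Lemma char_poly_lex : char_poly (distmx C L) =
  \det (tens_ones (map_mx polyC D + 2%:M) (map_mx polyC A + ('X + 2)%:M)).
Proof.
rewrite -lex_tensorE -(det_mxsub_bij _ (@lex_index_bij G H)) distL.
congr (\det _); apply/matrixP => i j.
rewrite !mxE (inj_eq index_inj) /=; congr (_ - _).
rewrite rmorphD !rmorphM !rmorphB /= !rmorphM /= polyC1 polyC_natr.
by congr (_ + _ * (_ - _ - _)); rewrite ?mulr1 rmorphMn /= ?polyC1 ?polyC_natr.
Qed.

(** In [det_tens_ones] both sides have the factor nu ^+ n, with
    nu = 'X + 2 + r: on the right it comes from the eigenvalue r of A. *)
Lemma char_poly_lex_factor (del alpha : seq C) :
  perm_eq (spec D) del -> perm_eq (spec A) (r%:R :: alpha) ->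
  char_poly (distmx C L) =
    (\prod_(d <- del) ('X - (m%:R * d + 2 * m%:R - 2 - r%:R)%:P)) *
    (\prod_(a <- alpha) ('X - (- (a + 2))%:P)) ^+ n.
Proof.
move=> Ddel Aalpha.
pose nu : {poly C} := 'X + 2 + r%:R.
have nuE : nu = 'X - (- (2 + r%:R))%:P.
  by rewrite polyCN opprK polyCD !polyC_natr addrA.
pose N := map_mx polyC A + ('X + 2)%:M.
have Nones : N *m const_mx 1 = nu *: const_mx 1 :> 'cV_m.
  rewrite mulmxDl mul_scalar_mx /nu [X in _ = X]scalerDl addrC; congr (_ + _).
  have -> : const_mx 1 = map_mx polyC (const_mx 1) :> 'cV[{poly C}]_m.
    by apply/matrixP => i j; rewrite !mxE.
  by rewrite -map_mxM (adjmx_ones outH) map_mxZ /= polyC_natr.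
have nu0 : nu ^+ n != 0 by rewrite expf_neq0 // nuE polyXsubC_eq0.
apply: (mulfI nu0); rewrite char_poly_lex (det_tens_ones _ Nones).
have -> : N = ('X + 2)%:M - (-1)%:P *: map_mx polyC A.
  by rewrite polyCN polyC1 scaleN1r opprK addrC.
have -> : nu%:M - m%:R *: (map_mx polyC D + 2%:M)
    = (nu - m%:R * 2)%:M - m%:R%:P *: map_mx polyC D.
  by rewrite scalerDr scale_scalar_mx polyC_natr raddfB /= opprD addrA addrAC.
rewrite (det_affine _ _ Ddel) // (det_affine _ _ Aalpha) ?oppr_eq0 ?oner_eq0 //.
rewrite big_cons exprMn -mulrA; congr (_ ^+ _ * _).
  by rewrite mulN1r polyCN opprK polyC_natr.
rewrite mulrC; congr (_ * _ ^+ _); apply: eq_bigr => x _.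
  rewrite /nu !(polyCD, polyCN, polyCM, polyC_natr); ring.
rewrite !(polyCD, polyCN, polyCM, polyC_natr, polyC1); ring.
Qed.

Lemma spec_lex (del alpha : seq C) :
  perm_eq (spec D) del -> perm_eq (spec A) (r%:R :: alpha) ->
  perm_eq (spec (distmx C L))
    ([seq m%:R * d + 2 * m%:R - 2 - r%:R | d <- del]
       ++ flatten [seq nseq n (- (a + 2)) | a <- alpha]).
Proof.
move=> Ddel Aalpha; apply: spec_perm.
rewrite (char_poly_lex_factor Ddel Aalpha) big_cat big_map big_flatten.
rewrite big_map /= -prodrXl.
by congr (_ * _); apply: eq_bigr => a _; rewrite big_nseq -Monoid.iteropE.
Qed.

Lemma gmult_lex z : gmult (distmx C L) z =
  (n * m - \rank (tens_ones (D + 2%:M) (A - (- z - 2)%:M)))%N.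
Proof.
rewrite gmultE; congr (_ - _)%N; first exact: card_prod.
have -> : A - (- z - 2)%:M = A + (z + 2)%:M.
  by rewrite -raddfN opprB opprK [2 + z]addrC.
rewrite -lex_tensorE -mxrank_opp opprB -(rank_mxsub_bij _ (@lex_index_bij G H)).
rewrite distL; congr mxrank.
by apply/matrixP => i j; rewrite !mxE (inj_eq index_inj).
Qed.

Section Multiplicity.

Variable z : C.

Let w := - z - 2.
Let zt := (z - 2 * m%:R + 2 + r%:R) / m%:R.
Let nu := r%:R - w.

Let N := A - w%:M.

Lemma adj_shift_ones : N *m const_mx 1 = nu *: const_mx 1 :> 'cV_m.
Proof. by rewrite mulmxBl mul_scalar_mx (adjmx_ones outH) -scalerBl. Qed.

Lemma lex_quotient : nu%:M - m%:R *: (D + 2%:M) = - (m%:R *: (D - zt%:M)).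
Proof.
apply/matrixP => i j; rewrite !mxE; case: (_ == _) => /=.
  by rewrite /nu /w /zt; field.
by rewrite /nu /w; ring.
Qed.

Lemma rank_lex_quotient :
  \rank (nu%:M - m%:R *: (D + 2%:M)) = \rank (D - zt%:M).
Proof. by rewrite lex_quotient mxrank_opp mxrank_scale_nz. Qed.

Lemma lex_quotient_unit :
  (nu%:M - m%:R *: (D + 2%:M) \in unitmx) = (zt \notin spec D).
Proof.
by rewrite mem_spec negbK -!row_free_unit /row_free rank_lex_quotient.
Qed.

(** Besides the orthogonal case of the theorem, this covers an invertible N,
    where the first summand is 0. *)
Lemma gmult_lex_sub : nu != 0 -> ((const_mx 1 : 'rV_m) <= N)%MS ->
  gmult (distmx C L) z = (n * gmult A w + gmult D zt)%N.
Proof.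
move=> nu0 ones_sub; rewrite gmult_lex !gmultE mulnBr; apply: nullity_add.
- by rewrite leq_mul2l rank_leq_row orbT.
- exact: rank_leq_row.
- rewrite (rank_tens_ones_sub _ adj_shift_ones nu0 ones_sub).
  by rewrite rank_lex_quotient.
Qed.

Lemma gmult_lex_unit : nu != 0 -> zt \notin spec D ->
  gmult (distmx C L) z = (n * gmult A w)%N.
Proof.
rewrite -lex_quotient_unit gmult_lex !gmultE mulnBr => nu0 Qu.
by rewrite (rank_tens_ones_unit adj_shift_ones nu0 Qu).
Qed.

Lemma gmult_lex_not_perp : nu != 0 -> ~ ES_perp_ones A w ->
  gmult (distmx C L) z = (n * gmult A w)%N.
Proof.
move=> nu0 /not_ES_perp_ones[v Nv v1]; rewrite gmult_lex !gmultE mulnBr.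
by rewrite (rank_tens_ones_section _ adj_shift_ones nu0 Nv v1).
Qed.

(** The shift by -1 replaces nu = 0 with -m and N with the invertible A - r - J,
    and leaves nu - m S unchanged. *)
Lemma gmult_lex_perron : nu = 0 -> gmult (distmx C L) z = gmult D zt.
Proof.
move=> nu0; rewrite gmult_lex gmultE -/N -(tens_ones_shift _ _ (-1)) scaleN1r.
have wr : w = r%:R by apply/esym/eqP; rewrite -subr_eq0 -/nu nu0.
have Nu : N - const_mx 1 \in unitmx by rewrite /N wr perron_unit.
have N1 : (N - const_mx 1) *m const_mx 1 = (nu - m%:R) *: const_mx 1 :> 'cV_m.
  rewrite mulmxBl adj_shift_ones [RHS]scalerBl mul_const_mx1; congr (_ - _).
  by apply/matrixP => i j; rewrite !mxE mulr1.
have num0 : nu - m%:R != 0 by rewrite nu0 sub0r oppr_eq0.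
have := rank_tens_ones_sub (D + 2%:M + (-1)%:M) N1 num0.
rewrite submx_full ?row_full_unit // => /(_ isT); rewrite (mxrank_unit Nu).
have -> : (nu - m%:R)%:M - m%:R *: (D + 2%:M + (-1)%:M)
    = nu%:M - m%:R *: (D + 2%:M).
  by apply/matrixP => i j; rewrite !mxE; case: (_ == _) => /=; ring.
rewrite rank_lex_quotient => /(nullity_add (leqnn _) (rank_leq_row _)) ->.
by rewrite subnn.
Qed.

Lemma gmult_lex_cases (alpha : seq C) :
  perm_eq (spec A) (r%:R :: alpha) ->
  let g := gmult D zt in
  let g' := gmult A w in
  let inA' := w \in rem r%:R (spec A) in
  let inD := zt \in spec D in
  let perp := ES_perp_ones A w in
  let k := gmult (distmx C L) z in
  [/\ ~~ inA' /\ inD -> k = g,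
      inA' /\ ~~ inD -> k = (n * g')%N,
      inA' /\ inD /\ perp -> k = (n * g' + g)%N,
      inA' /\ inD /\ ~ perp -> k = (n * g')%N
    & ~~ inA' /\ ~~ inD -> k = 0%N].
Proof.
move=> Aalpha g g' inA' inD perp k.
have inA'E : inA' = (w \in alpha).
  have r_spec : r%:R \in spec A by rewrite (perm_mem Aalpha) mem_head.
  by apply: perm_mem; rewrite -(perm_cons r%:R) -(permPl (perm_to_rem r_spec)).
have r_alpha : r%:R \notin alpha.
  exact: simple_ones_root (adjmx_ones outH C) (perron_unit scH outH C) Aalpha.
have nu_neq0 : inA' -> nu != 0.
  by rewrite inA'E subr_eq0 => wa; apply: contraNneq r_alpha => ->.
have not_inA' : ~~ inA' -> k = g.
  move=> w'; have [/gmult_lex_perron //|nu0] := eqVneq nu 0.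
  have Nu : N \in unitmx.
    rewrite -[_ \in _]negbK -mem_spec (perm_mem Aalpha) inE negb_or -inA'E w'.
    by rewrite andbT eq_sym -subr_eq0.
  rewrite /k gmult_lex_sub ?submx_full ?row_full_unit //.
  by rewrite [gmult A w]gmultE mxrank_unit // subnn muln0.
have g0 : ~~ inD -> g = 0%N.
  by rewrite /inD mem_spec negbK /g gmultE => Du; rewrite mxrank_unit // subnn.
split=> [[w' _]|[w' z']|[w' [_ p]]|[w' [_ p]]|[w' /g0 <-]].
- exact: not_inA'.
- by apply: gmult_lex_unit => //; apply: nu_neq0.
- by apply: gmult_lex_sub; [apply: nu_neq0 | apply: ES_perp_onesP].
- by apply: gmult_lex_not_perp => //; apply: nu_neq0.
- exact: not_inA'.
Qed.

End Multiplicity.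

End LexSpectrum.

Theorem theorem3p15 (R : realType) (G G' : digraph) (n n' r' : nat)
  (hn : #|G| = n) (hn' : #|G'| = n')
  (scG : strongly_connected G) (scG' : strongly_connected G')
  (dblG : forall u : G, in_double_arc u)
  (outG' : forall u : G', outdeg u = r')
  (del : n.-tuple R[i]) (alpha : n'.-1.-tuple R[i])
  (hdel : perm_eq (spec (distmx R[i] G)) del)
  (halpha : perm_eq (spec (adjmx R[i] G')) (r'%:R :: alpha)) :
  perm_eq (spec (distmx R[i] (lexprod G G')))
    ([seq n'%:R * d + 2 * n'%:R - 2 - r'%:R | d <- del]
       ++ flatten [seq nseq n (- (a + 2)) | a <- alpha])
  /\
  forall z : R[i],
    let zt := (z - 2 * n'%:R + 2 + r'%:R) / n'%:R in
    let g := gmult (distmx R[i] G) zt in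
    let g' := gmult (adjmx R[i] G') (- z - 2) in
    let inA' := - z - 2 \in rem r'%:R (spec (adjmx R[i] G')) in
    let inD := zt \in spec (distmx R[i] G) in
    let perp := ES_perp_ones (adjmx R[i] G') (- z - 2) in
    let m := gmult (distmx R[i] (lexprod G G')) z in
    [/\ ~~ inA' /\ inD -> m = g,
        inA' /\ ~~ inD -> m = (n * g')%N,
        inA' /\ inD /\ perp -> m = (n * g' + g)%N,
        inA' /\ inD /\ ~ perp -> m = (n * g')%N
      & ~~ inA' /\ ~~ inD -> m = 0%N].
Proof.
subst n n'; split; first exact: spec_lex.
by move=> z; apply: gmult_lex_cases halpha.
Qed.
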